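(* Let $X$ be a compact metric space. There exists a hyper-expansive homeomorphism $f\colon X\to X$ if and only if $2\le |\mathrm{Lim}(X)|<\infty$ or $\mathrm{Lim}(X)=\emptyset$ (i.e., $X$ is finite).
   Context: For a compact metric space $(X,\operatorname{dist})$, write $B_\epsilon(x)=\{y\in X:\operatorname{dist}(x,y)<\epsilon\}$ and $B_\epsilon(A)=\bigcup_{x\in A}B_\epsilon(x)$. $\mathrm{Iso}(X)=\{x\in X:\text{there is }\epsilon>0\text{ such that }B_\epsilon(x)=\{x\}\}$ is the set of isolated points and $\mathrm{Lim}(X)=X\setminus\mathrm{Iso}(X)$ is the set of limit points. $|A|$ denotes the cardinality of a set $A$. $2^X$ denotes the set of all nonempty compact subsets of $X$, with the Hausdorff metric $\operatorname{dist}_H(A,B)=\inf\{\epsilon>0: A\subset B_\epsilon(B)\text{ and }B\subset B_\epsilon(A)\}$. A homeomorphism $f\colon X\to X$ is hyper-expansive if there is $\delta>0$ such that whenever $A,B\in 2^X$ satisfy $\operatorname{dist}_H(f^n(A),f^n(B))<\delta$ for all $n\in\mathbb{Z}$, then $A=B$. *)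

(* Defs.v *)
From HB Require Import structures.
From mathcomp Require Import all_boot all_order all_algebra.
From mathcomp Require Import all_classical all_reals topology.
Set Implicit Arguments.
Unset Strict Implicit.
Unset Printing Implicit Defensive.
Import Order.TTheory GRing.Theory Num.Theory.
Local Open Scope classical_set_scope.
Local Open Scope ring_scope.

Definition Iso (R : realType) (X : metricType R) : set X := isolated [set: X].
Arguments Iso {R} X.

Definition Lim (R : realType) (X : metricType R) : set X := ~` Iso X.
Arguments Lim {R} X.

Lemma IsoE (R : realType) (X : metricType R) :
  Iso X = [set x | exists2 e : R, 0 < e & [set y | mdist x y < e] = [set x]].
Proof.
apply/seteqP; split => x.
  move=> [_ [V /nbhs_ballP[e /= e0 eV]]]; rewrite setIT => Vx.
  exists e => //; rewrite -ballEmdist; apply/seteqP; split.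
    by rewrite -[X in _ `<=` X]Vx.
  by move=> _ ->; exact: ballxx.
move=> [e e0]; rewrite -ballEmdist => xe; split; first exact: mem_set.
exists (ball x e); last by rewrite setIT.
exact: nbhsx_ballx.
Qed.

Definition set_ball (R : realType) (X : metricType R) (A : set X) (e : R)
    : set X :=
  \bigcup_(x in A) [set y | mdist x y < e].

Definition hyperspace (R : realType) (X : metricType R) : set (set X) :=
  [set A | A !=set0 /\ compact A].
Arguments hyperspace {R} X.

Definition hausdorff_dist (R : realType) (X : metricType R) (A B : set X) : R :=
  inf [set e : R | [/\ 0 < e, A `<=` set_ball B e & B `<=` set_ball A e]].

(* A splitbij carries its inverse [f^-1]%FUN as part of its structure. *)
Definition homeomorphism (R : realType) (X : metricType R)
    (f : {splitbij [set: X] >-> [set: X]}) : Prop :=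
  continuous f /\ continuous (f^-1)%FUN.

(* [Negz k] denotes the integer - (k + 1). *)
Definition int_iter (R : realType) (X : metricType R)
    (f : {splitbij [set: X] >-> [set: X]}) (n : int) : X -> X :=
  match n with
  | Posz k => iter k f
  | Negz k => iter k.+1 (f^-1)%FUN
  end.

Definition hyper_expansive (R : realType) (X : metricType R)
    (f : {splitbij [set: X] >-> [set: X]}) : Prop :=
  exists2 delta : R, 0 < delta &
    forall A B : set X, hyperspace X A -> hyperspace X B ->
      (forall n : int,
         hausdorff_dist (int_iter f n @` A) (int_iter f n @` B) < delta) ->
      A = B.

(* Main.v *)
Require Import Defs.
From mathcomp Require Import all_boot all_order all_algebra.
From mathcomp Require Import all_classical all_reals topology.
From mathcomp Require Import lra zify.
Set Implicit Arguments.
Unset Strict Implicit.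
Unset Printing Implicit Defensive.
Import Order.TTheory GRing.Theory Num.Theory.
Local Open Scope classical_set_scope.
Local Open Scope ring_scope.

(** The proof rests on a dictionary between hyper-expansivity and attracting
    or repelling neighbourhoods of the limit points.

    Necessity.  Let d0 be a constant of hyper-expansivity of f, and put
    d = d0 / 2.  For a point x and e > 0, the compact sets
    {x} `|` (X \ B_e(x)) and X \ B_e(x) differ, hence some iterate separates
    them; this forces B_d(f^n x) to lie inside f^n (B_e(x)) for some integer n
    ([hyper_expansive_expands]).  When x is a limit point, |n| is unbounded as
    e tends to 0, so one of f, f^-1, call it g, shrinks a fixed ball C,
    centred at a cluster point of the orbit of x, to the point x along
    arbitrarily large times ([expands_contracted_ball]).  Two such times n0 <
    n1, the second chosen after the first, give g^(n1 - n0) C included in C.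
    Transporting C to x yields an open neighbourhood V of x which some positive
    power G of g maps into itself and shrinks to x ([expands_trap]).
    Consequently x is fixed by G and is the only periodic point of V.  So all
    limit points are periodic and isolated from each other, and by compactness
    there are finitely many.  If there were a single one, the complement of V
    would be finite and stable under the injection G^-1, hence G^-1 would
    preserve V too, and V = {x} would be open ([trap_Lim_neq1]).

    Sufficiency.  A finite X carries the identity.  Otherwise split X into
    clopen sets V_p, one around each limit point p; each V_p \ {p} is a sequence
    converging to p.  One limit point p1 is made a repeller and the others
    attractors: for each q <> p1, a single orbit of isolated points leaves p1
    along part of V_p1 and then enumerates V_q \ {q}
    ([orbit_coding], [attractors_repeller_homeo]).  The set V_p is then a
    funnel towards p for one of f, f^-1: its image lies in V_p and misses only
    finitely many points of V_p, and each point of V_p other than p leaves V_p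
    under the inverse map.  Funnels give continuity, since f moves only finitely
    many points from one V_p to another, and hyper-expansivity
    ([funnels_hyper_expansive]).  Indeed, let a point belong to A and not to B.
    If it is isolated, A and B are told apart when its orbit passes through one
    of the finitely many points by which orbits enter the funnels; if it is a
    limit point p, they are told apart once B has been driven out of V_p. *)

(** * Uniform choices over a finite set, isolated points and compactness *)

Section FiniteUniform.
Variables (T : eqType) (S : set T).
Hypothesis finS : finite_set S.

(** Common source of the uniform radii and uniform times used below: [m]
    combines two witnesses into one that serves for both. *)
Lemma finite_uniform (I : Type) (D : set I) (m : I -> I -> I)
    (P : T -> I -> Prop) :
  D !=set0 ->
  (forall i j, D i -> D j -> D (m i j)) ->
  (forall s i j, D i -> D j -> P s i \/ P s j -> P s (m i j)) ->
  (forall s, S s -> exists2 i, D i & P s i) ->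
  exists2 i, D i & forall s, S s -> P s i.
Proof.
move=> [i0 Di0] Dm Pm; have /finite_seqP[l ->] := finS.
elim: l => [|a l IH] Pl; first by exists i0.
have [i Di Pi] := Pl a (mem_head _ _).
have [|j Dj Pj] := IH; first by move=> s sl; apply: Pl; rewrite /= inE sl orbT.
exists (m i j); first exact: Dm.
move=> s /=; rewrite inE => /orP[/eqP ->|/Pj Psj]; apply: Pm => //.
  by left.
by right.
Qed.

Lemma finite_uniform_radius (R : realType) (P : T -> R -> Prop) :
  (forall s e e', P s e -> 0 < e' -> e' <= e -> P s e') ->
  (forall s, S s -> exists2 e : R, 0 < e & P s e) ->
  exists2 e : R, 0 < e & forall s, S s -> P s e.
Proof.
move=> Pdown; apply: (@finite_uniform _ (fun e : R => 0 < e) Num.min).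
- by exists 1; exact: ltr01.
- by move=> i j i0 j0; rewrite /= lt_min i0.
- by move=> s i j i0 j0 [] /Pdown; apply;
  rewrite ?lt_min ?i0 ?ge_min ?lexx ?orbT.
Qed.

Lemma finite_uniform_time (P : T -> nat -> Prop) :
  (forall s n, P s n -> P s n.+1) ->
  (forall s, S s -> exists n, P s n) ->
  exists n, forall s, S s -> P s n.
Proof.
move=> Pup Pex.
have Ple s i j : (i <= j)%N -> P s i -> P s j.
  by move=> /subnK <-; elim: (j - i)%N => // n IH /IH; exact: Pup.
have [||||n _ Pn] := @finite_uniform _ [set: nat] maxn P; last by exists n.
- by exists 0%N.
- by [].
- by move=> s i j _ _ [] /Ple; apply; rewrite ?leq_maxl ?leq_maxr.
- by move=> s /Pex[n Pn]; exists n.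
Qed.
End FiniteUniform.

Section Topology.
Variables (R : realType) (X : metricType R).
Implicit Types (x y : X) (K U V : set X).

Lemma nbhs_mdist x U :
  nbhs x U <-> exists2 e : R, 0 < e & forall y, mdist x y < e -> U y.
Proof.
rewrite -nbhs_ballE; split=> -[e e0 eU]; exists e => //.
  by move=> y xy; apply: eU; rewrite ballEmdist.
by rewrite ballEmdist.
Qed.

Lemma open_mdist_ball x (e : R) : open [set y | mdist x y < e].
Proof.
rewrite openE => y xy; apply/nbhs_mdist; exists (e - mdist x y).
  by rewrite subr_gt0.
move=> z yz; have := metric_triangle x y z; rewrite /=.
by move: xy yz; rewrite /=; lra.
Qed.

Lemma mdist_small_eq x y : (forall e : R, 0 < e -> mdist x y < e) -> x = y.
Proof.
move=> xy; apply/eqP; apply: contrapT => /negP; rewrite -mdist_gt0 => /xy.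
by rewrite ltxx.
Qed.

Lemma Iso_open_set1 x : Iso X x <-> open [set x].
Proof.
rewrite IsoE; split=> [[e e0 xe]|ox].
  by rewrite -xe; exact: open_mdist_ball.
have /nbhs_mdist[e e0 eV] : nbhs x [set x] by exact: open_nbhs_nbhs.
exists e => //; apply/seteqP; split=> [y /eV //|_ ->] /=.
by rewrite mdistxx.
Qed.

Lemma IsoP x :
  Iso X x <-> exists2 e : R, 0 < e & forall y, mdist x y < e -> y = x.
Proof.
rewrite IsoE; split=> -[e e0 xe]; exists e => //.
  by move=> y xy; have : [set y | mdist x y < e] y by []; rewrite xe.
by apply/seteqP; split=> [y /xe //|_ ->] /=; rewrite mdistxx.
Qed.

Lemma open_Iso : open (Iso X).
Proof.
rewrite openE => x /Iso_open_set1 ox.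
apply: (@filterS _ _ _ [set x]); last exact: open_nbhs_nbhs.
by move=> _ ->; exact/Iso_open_set1.
Qed.

Lemma closed_Lim : closed (Lim X).
Proof. exact/open_closedC/open_Iso. Qed.

Lemma notLimP x : ~ Lim X x <-> Iso X x.
Proof. by split=> [/contrapT|? ?]. Qed.

(** Isolated points are interior to any set containing them, so that openness
    only has to be tested at limit points. *)
Lemma open_nbhs_Lim U : (forall p, Lim X p -> U p -> nbhs p U) -> open U.
Proof.
move=> oU; rewrite openE => x Ux.
have [Lx|/notLimP/Iso_open_set1 ox] := pselect (Lim X x).
  exact: oU.
by apply: (@filterS _ _ _ [set x]) => [_ -> //|]; exact: open_nbhs_nbhs.
Qed.

Hypothesis cX : compact [set: X].

Lemma closed_compactX K : closed K -> compact K.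
Proof. by move=> cK; exact: subclosed_compact cK cX _. Qed.

Lemma compact_discrete_finite K : closed K ->
  (forall x, K x ->
     exists V, [/\ open V, V x & forall y, K y -> V y -> y = x]) ->
  finite_set K.
Proof.
move=> /closed_compactX /compact_near_coveringP coverK discK.
(* the families containing every set that is large enough, that is, every
   superset of a certain finite set *)
pose F : set_system (set X) :=
  [set A | exists2 D, finite_set D & forall D', D `<=` D' -> A D'].
have FF : Filter F.
  split=> [|A B [D fD DA] [E fE EB]|A B AB [D fD DA]].
  - by exists set0.
  - exists (D `|` E); first by rewrite finite_setU.
    by move=> D'; rewrite subUset => -[DD' ED']; split; [exact: DA|exact: EB].
  - by exists D => // D' /DA /AB.
have [|D fD KD] := coverK _ F (fun D y => K y -> D y) FF; last first.
  by apply: sub_finite_set fD => y Ky; exact: (KD D _ y).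
move=> x /discK[V [oV Vx Vx1]]; exists (V, [set D | D x]).
  split; first exact: open_nbhs_nbhs.
  by exists [set x] => [//|D' xD']; exact: xD'.
by move=> [y D] [/= Vy Dx] /Vx1 ->.
Qed.

Lemma closed_noLim_finite K : closed K -> (forall x, K x -> ~ Lim X x) ->
  finite_set K.
Proof.
move=> cK KL; apply: compact_discrete_finite => // x.
move=> /KL/notLimP/Iso_open_set1 ox.
by exists [set x].
Qed.

End Topology.

(** * Hausdorff distance and iterates *)

Section Hausdorff.
Variables (R : realType) (X : metricType R).
Implicit Types (x y : X) (A B : set X).

Lemma hausdorff_dist_le A B (e : R) : 0 < e ->
  A `<=` set_ball B e -> B `<=` set_ball A e -> hausdorff_dist A B <= e.
Proof.
move=> e0 AB BA; apply: ge_inf; last by split.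
by exists 0 => r [/ltW].
Qed.

Lemma compact_bounded : compact [set: X] ->
  exists2 M : R, 0 < M & forall x y, mdist x y < M.
Proof.
move=> cX; have [[x0]|X0] := pselect (inhabited X); last first.
  by exists 1 => [//|x]; exfalso; apply: X0; exists.
suff [M M0 x0M] : exists2 M : R, 0 < M & forall x, mdist x0 x < M.
  exists (M + M) => [|x y]; first exact: addr_gt0.
  have := metric_triangle x x0 y; rewrite (metric_sym x x0).
  have := x0M x; have := x0M y; lra.
pose F : set_system R := [set A | exists M : R, forall M', M <= M' -> A M'].
have FF : Filter F.
  split=> [|A B [M MA] [N NB]|A B AB [M MA]].
  - by exists 0.
  - by exists (Num.max M N) => M'; rewrite ge_max => /andP[/MA ? /NB].
  - by exists M => M' /MA /AB.
have /compact_near_coveringP/(_ _ F (fun M x => mdist x0 x < M) FF) := cX.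
case=> [x _|M /(_ (Num.max M 1)) MP].
  exists ([set y | mdist x y < 1], [set M | mdist x0 x + 1 <= M]).
    split; last by exists (mdist x0 x + 1).
    by apply/nbhs_mdist; exists 1.
  move=> [y M] [/= xy xM]; have := metric_triangle x0 x y; lra.
exists (Num.max M 1); first by rewrite lt_max ltr01 orbT.
by move=> x; apply: MP => //; rewrite le_max lexx.
Qed.

(** Boundedness of X matters here: the infimum of an empty set of radii would
    be 0 and carry no information. *)
Lemma hausdorff_dist_lt A B (e : R) :
  compact [set: X] -> A !=set0 -> B !=set0 ->
  hausdorff_dist A B < e ->
  (forall x, A x -> exists2 y, B y & mdist x y < e) /\
  (forall y, B y -> exists2 x, A x & mdist y x < e).
Proof.
move=> /compact_bounded[M M0 XM] [a Aa] [b Bb] /inf_lt[|d [d0 AB BA] de].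
  exists M; split=> // x _; first by exists b => //=; exact: XM.
  by exists a => //=; exact: XM.
by split=> [x /AB[y By]|y /BA[x Ax]] /= xy; [exists y|exists x] => //;
  rewrite metric_sym; exact: lt_trans xy de.
Qed.

End Hausdorff.

Section Iterates.
Variables (R : realType) (X : metricType R).
Variable f : {splitbij [set: X] >-> [set: X]}.

Lemma splitbij_cancel : cancel f (f^-1)%FUN.
Proof. by move=> x; apply: funK; rewrite inE. Qed.

Lemma splitbij_cancelV : cancel (f^-1)%FUN f.
Proof. by move=> x; apply: invK; rewrite inE. Qed.

Lemma int_iterV n : exists m : int, int_iter f m = iter n (f^-1)%FUN.
Proof. by case: n => [|n]; [exists 0|exists (Negz n)]. Qed.

End Iterates.

(** * Hyper-expansivity expands small balls to a definite size *)

Section Expansion.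
Variables (R : realType) (X : metricType R).
Implicit Types (x y : X) (U V : set X).

Lemma iter_cancel (g h : X -> X) n : cancel g h -> cancel (iter n g) (iter n h).
Proof.
move=> gK; elim: n => // n IH x.
by rewrite iterSr iterS gK IH.
Qed.

Lemma iter_continuous (g : X -> X) n : continuous g -> continuous (iter n g).
Proof.
move=> cg; elim: n => [|n IH] x; first exact: cvg_id.
exact: (continuous_comp (IH x) (cg _)).
Qed.

(** For mutually inverse [g] and [h], some iterate of [h] stretches the ball of
    radius [e] at [x] over the whole ball of radius [d] at the image of [x]. *)
Definition expands_at (g h : X -> X) (x : X) (d : R) : Prop :=
  forall e : R, 0 < e ->
  exists n, forall y, mdist (iter n h x) y < d -> mdist x (iter n g y) < e.

(** For fixed [x] and [e], if no iterate of f stretched the ball of radius [e]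
    at [x], then the compact sets x |` B and B below, where B is the complement
    of that ball, would stay close forever.  The direction of time depends
    on [e]; as the property is monotone in [e], one direction serves for all. *)
Lemma hyper_expansive_expands (f : {splitbij [set: X] >-> [set: X]}) :
  compact [set: X] -> hyper_expansive f ->
  exists2 d : R, 0 < d & forall x,
    expands_at f (f^-1)%FUN x d \/ expands_at (f^-1)%FUN f x d.
Proof.
move=> cX [d0 d0_gt0 hf]; exists (d0 / 2) => [|x]; first by lra.
set d := d0 / 2; have d_gt0 : 0 < d by rewrite /d; lra.
pose good g h (e : R) := exists n, forall y : X,
  mdist (iter n h x) y < d -> mdist x (iter n g y) < e.
have fK := splitbij_cancel f; have fVK := splitbij_cancelV f.
have step e : 0 < e -> good f (f^-1)%FUN e \/ good (f^-1)%FUN f e.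
  move=> e0; apply: contrapT => /not_orP[bf bfV].
  have esc g h n : cancel g h -> ~ good g h e ->
      exists2 y, e <= mdist x y & mdist (iter n h x) (iter n h y) < d.
    move=> gK /forallNP/(_ n)/existsNP[z /not_implyP[xz /negP]].
    rewrite -leNgt => exz; exists (iter n g z) => //.
    by rewrite iter_cancel.
  pose B := [set y | e <= mdist x y].
  have cB : compact B.
    apply: closed_compactX => //; rewrite (_ : B = ~` [set y | mdist x y < e]).
      exact/open_closedC/open_mdist_ball.
    by apply/seteqP; split=> y; rewrite /B /setC /= leNgt => /negP.
  have esc' n : exists2 y, B y & mdist (int_iter f n x) (int_iter f n y) < d.
    case: n => n; first exact: (esc _ (f : X -> X) n fVK bfV).
    exact: (esc _ _ n.+1 fK bf).
  have B0 : B !=set0 by have [y By _] := esc' 0; exists y.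
  have : x |` B = B.
    apply: hf.
    - by split; [exists x; left|apply: compactU => //; exact: compact_set1].
    - by split.
    move=> n; apply: (@le_lt_trans _ _ d); last by rewrite /d; lra.
    apply: hausdorff_dist_le => //.
    + move=> _ [y [->|By] <-].
        have [z Bz xz] := esc' n.
        exists (int_iter f n z); first by exists z.
        by rewrite /= metric_sym.
      exists (int_iter f n y); first by exists y.
      by rewrite /= mdistxx.
    + move=> _ [y By <-].
      exists (int_iter f n y); first by exists y => //; right.
      by rewrite /= mdistxx.
  move=> /seteqP[/(_ x (or_introl erefl)) + _].
  by rewrite /B /= mdistxx leNgt e0.
have [//|] := pselect (expands_at f (f^-1)%FUN x d); first by left.
move=> /existsNP[e /not_implyP[e0 nf]]; right=> e' e'0.
have [|[n nP]|[n nP]] := step (Num.min e e'); first by rewrite lt_min e0.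
  exfalso; apply: nf; exists n => y /nP; rewrite lt_min => /andP[] //.
by exists n => y /nP; rewrite lt_min => /andP[].
Qed.

End Expansion.

(** * Trapping neighbourhoods of limit points *)

Lemma iter_comm (T : Type) (g h : T -> T) m n :
  (forall z, g (h z) = h (g z)) ->
  forall z, iter m g (iter n h z) = iter n h (iter m g z).
Proof.
move=> gh.
have gh1 k z : g (iter k h z) = iter k h (g z).
  by elim: k => //= k IH; rewrite gh IH.
by elim: m => //= m IH z; rewrite IH gh1.
Qed.

Section Trap.
Variables (R : realType) (X : metricType R).
Implicit Types (x y : X) (U V : set X).

Definition traps (g : X -> X) V x : Prop :=
  [/\ open V, V x, forall y, V y -> V (g y) &
    forall e : R, 0 < e -> exists j, forall y, V y -> mdist x (iter j g y) < e].

Lemma continuous_mdist (g : X -> X) : continuous g -> forall x (e : R), 0 < e ->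
  exists2 d : R, 0 < d & forall y, mdist x y < d -> mdist (g x) (g y) < e.
Proof.
move=> cg x e e0; apply/nbhs_mdist; apply: (cg x [set z | mdist (g x) z < e]).
by apply/nbhs_mdist; exists e.
Qed.

(** If the expansion times stayed bounded, a fixed iterate would stretch
    arbitrarily small balls at [x], and continuity would make [x] isolated. *)
Lemma expands_large_times (g h : X -> X) x (d : R) :
  continuous h -> cancel h g -> Lim X x -> 0 < d -> expands_at g h x d ->
  forall (e : R) m, 0 < e -> exists2 n, (m <= n)%N &
    forall y, mdist (iter n h x) y < d -> mdist x (iter n g y) < e.
Proof.
move=> ch hK Lx d0 gx e m e0.
pose S (e : R) n :=
  forall y, mdist (iter n h x) y < d -> mdist x (iter n g y) < e.
have Sle n e1 e2 : e1 <= e2 -> S e1 n -> S e2 n.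
  by move=> e12 Se y /Se /lt_le_trans; exact.
have [e1 e1_gt0 nS] : exists2 e1 : R, 0 < e1 & forall n, `I_m n -> ~ S e1 n.
  apply: finite_uniform_radius => [|n e1 e2 nS _ e21 /(Sle _ _ _ e21) //|n _].
    exact: finite_II.
  apply: contrapT => nS; apply: Lx; apply/IsoP.
  have [b b0 xb] := continuous_mdist (iter_continuous (n := n) ch) x d0.
  exists b => // y xy; apply/esym/mdist_small_eq => e1 e1_gt0.
  have Se1 : S e1 n by apply: contrapT => ?; apply: nS; exists e1.
  by rewrite -[y](iter_cancel n hK); exact/Se1/xb.
have [|n Sn] := gx (Num.min e e1); first by rewrite lt_min e0.
exists n.
  rewrite leqNgt; apply/negP => /nS; apply.
  by apply: Sle Sn; rewrite ge_min lexx orbT.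
by apply: Sle Sn; rewrite ge_min lexx.
Qed.

Hypothesis cX : compact [set: X].

(** The balls of radius [d] that are contracted to [x] have moving centres; at
    times when the centre is near a fixed cluster point, they all contain a
    fixed ball around that point. *)
Lemma expands_contracted_ball (g h : X -> X) x (d : R) :
  continuous h -> cancel h g -> Lim X x -> 0 < d -> expands_at g h x d ->
  exists C : set X, open C /\ forall (e : R) m, 0 < e ->
    exists n, [/\ (m <= n)%N, C (iter n h x) &
                  forall y, C y -> mdist x (iter n g y) < e].
Proof.
move=> ch hK Lx d0 gx; have large := expands_large_times ch hK Lx d0 gx.
pose S (e : R) n :=
  forall y, mdist (iter n h x) y < d -> mdist x (iter n g y) < e.
(* a cluster point of F is one of the iterates of x under h along the
   expansion times *)
pose F : set_system X := [set A | exists2 e : R, 0 < e & exists m,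
  forall n, (m <= n)%N -> S e n -> A (iter n h x)].
have PF : ProperFilter F.
  split.
    by move=> [e e0 [m mF]]; have [n mn /(mF n mn)] := large e m e0.
  split=> [|A B [e e0 [m mA]] [b b0 [k kB]]|A B AB [e e0 [m mA]]].
  - by exists 1; [exact: ltr01|exists 0%N].
  - exists (Num.min e b); first by rewrite lt_min e0.
    exists (maxn m k) => n; rewrite geq_max => /andP[mn kn] Sn.
    by split; [apply: mA|apply: kB] => // y /Sn; rewrite lt_min => /andP[].
  - by exists e => //; exists m => n mn /mA /AB; exact.
have [|p [_ pF]] := cX PF; first exact: filterT.
exists [set y | mdist p y < d / 2]; split; first exact: open_mdist_ball.
move=> e m e0.
have [||_ [[n [mn Sn] <-] pn]] :=
    pF [set iter n h x | n in [set n | (m <= n)%N /\ S e n]]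
       [set y | mdist p y < d / 4].
- by exists e => //; exists m => n mn Sn; exists n.
- by apply/nbhs_mdist; exists (d / 4) => //; lra.
exists n; move: pn; rewrite /= => pn; split=> //; first by lra.
move=> y /= py; apply: Sn; have := metric_triangle (iter n h x) p y.
by rewrite (metric_sym (iter n h x) p); lra.
Qed.

(** Let C be the contracted ball and [n0] a contraction time.  At a much later
    contraction time [n1], the image of C is so close to [x] that [n0] steps
    backwards bring it into C; so [n1 - n0] forward steps map C into itself.
    Contraction times of one fixed residue [s] modulo [n1 - n0] still
    contract C arbitrarily well, and the trap is the image of C at time [s]. *)
Lemma expands_trap (g h : X -> X) x (d : R) :
  continuous h -> cancel g h -> cancel h g -> Lim X x -> 0 < d ->
  expands_at g h x d ->
  exists N V, traps (iter N.+1 g) V x.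
Proof.
move=> ch gK hK Lx d0 gx.
have [C [oC CP]] := expands_contracted_ball ch hK Lx d0 gx.
have gh z : h (g z) = g (h z) by rewrite gK hK.
have [n0 [_ Cn0 _]] := CP 1 0%N ltr01.
have [e1 e1_gt0 xe1] : exists2 e : R, 0 < e &
    forall y, mdist x y < e -> C (iter n0 h y).
  apply/nbhs_mdist; apply: (iter_continuous (n := n0) ch).
  exact: open_nbhs_nbhs.
have [n1 [n01 _ n1e]] := CP e1 n0.+1 e1_gt0.
pose N := (n1 - n0).-1; exists N.
have n1E : n1 = (n0 + N.+1)%N by rewrite /N; lia.
have CN y : C y -> C (iter N.+1 g y).
  move=> Cy; rewrite -[iter N.+1 g y](iter_cancel n0 gK) -iterD -n1E.
  exact/xe1/n1e.
have CjN j y : C y -> C (iter (j * N.+1) g y).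
  by rewrite iterM; elim: j => // j IH /IH; exact: CN.
have [s [sN sP]] : exists s, (s < N.+1)%N /\ forall e : R, 0 < e -> exists j,
    C (iter (j * N.+1 + s) h x) /\
    forall y, C y -> mdist x (iter (j * N.+1 + s) g y) < e.
  apply: contrapT => nP.
  have [e e0 bad] : exists2 e : R, 0 < e & forall s, `I_N.+1 s ->
      forall n, (n %% N.+1)%N = s ->
      ~ (C (iter n h x) /\ forall y, C y -> mdist x (iter n g y) < e).
    apply: finite_uniform_radius => [|s e e' nP' _ e'e n ns [Cn xe']|s sN].
    - exact: finite_II.
    - by apply: (nP' n ns); split=> // y /xe' /lt_le_trans; exact.
    apply: contrapT => bad; apply: nP; exists s; split=> // e e0.
    apply: contrapT => /forallNP nj; apply: bad; exists e => // n ns.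
    by have := nj (n %/ N.+1)%N; rewrite -ns -divn_eq.
  have [n [_ Cn nC]] := CP e 0%N e0.
  by apply: (bad (n %% N.+1)%N _ n) => //=; rewrite ltn_mod.
exists (iter s h @^-1` C); split.
- by apply: open_comp => // y _; exact: iter_continuous.
- have [j [Cj _]] := sP 1 ltr01; rewrite /preimage /=.
  by rewrite -[iter s h x](iter_cancel (j * N.+1) hK) -iterD; exact: CjN.
- by move=> y /CN; rewrite /preimage /= -!iterS (iter_comm _ _ gh).
move=> e /sP[j [_ je]]; exists j => y /je.
by rewrite -iterM iterD iter_cancel.
Qed.

(** Both [x] and [g x] lie in the trap, so the same iterates of [g] bring them
    close to [x]; by continuity these iterates of [g x] are also close to
    [g x]. *)
Lemma trap_fixed (g : X -> X) V x : continuous g -> traps g V x -> g x = x.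
Proof.
move=> cg [_ Vx Vg gV]; apply/esym/mdist_small_eq => e e0.
have e2_gt0 : 0 < e / 2 by lra.
have [b b0 xb] := continuous_mdist cg x e2_gt0.
have [|j jP] := gV (Num.min b (e / 2)); first by rewrite lt_min b0.
have /jP := Vx; rewrite lt_min => /andP[/xb xj _].
have /jP := Vg x Vx; rewrite lt_min -iterSr iterS => /andP[_ xgj].
have := metric_triangle x (g (iter j g x)) (g x).
by rewrite (metric_sym (g _) (g x)); lra.
Qed.

Lemma trap_periodic (g : X -> X) V x y k :
  traps g V x -> V y -> iter k.+1 g y = y -> y = x.
Proof.
move=> [_ _ Vg gV] Vy yk; apply/esym/mdist_small_eq => e /gV[j jP].
have Vi i : V (iter i g y) by elim: i => //= i /Vg.
(* j + j * k steps are j full periods of y *)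
have := jP _ (Vi (j * k)%N); rewrite -iterD -mulnS iterM.
by rewrite (_ : iter j _ y = y) //; elim: j {jP} => // j IH; rewrite iterS IH.
Qed.

(** If [x] were the only limit point, the complement of the trap would be
    finite.  A point of V sent out of V by [h] has an infinite forward
    [h]-orbit in that complement: a repetition would bring it back to V. *)
Lemma trap_Lim_neq1 (g h : X -> X) V x : cancel g h -> cancel h g ->
  traps g V x -> Lim X <> [set x].
Proof.
move=> gK hK [oV Vx Vg gV] Lx.
have finV : finite_set (~` V).
  apply: closed_noLim_finite => //; first exact: open_closedC.
  by move=> y nVy; rewrite Lx => yx; apply: nVy; rewrite yx.
have hVC y : ~ V y -> ~ V (h y) by move=> nVy /Vg; rewrite hK.
have hV y : V y -> V (h y).
  apply: contraPP => nVhy Vy.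
  have nVi n : ~ V (iter n.+1 h y) by elim: n => // n /hVC.
  have no_return i j : (i < j)%N -> iter i.+1 h y <> iter j.+1 h y.
    move=> ij ijE; apply: (nVi (j - i).-1).
    rewrite (_ : (j - i).-1.+1 = (j - i)%N); last by lia.
    rewrite (_ : iter _ h y = y) //; apply: (can_inj (iter_cancel i.+1 hK)).
    by rewrite -iterD ijE; congr (iter _ h y); lia.
  have inj_iter : {in [set: nat] &, injective (fun n => iter n.+1 h y)}.
    by move=> i j _ _ ijE; case: (ltngtP i j) => // /no_return; rewrite ijE.
  case: infinite_nat; rewrite -(eq_finite_set (inj_card_eq inj_iter)).
  by apply: (sub_finite_set _ finV) => _ [n _ <-]; exact: nVi.
have V1 y : V y -> y = x.
  move=> Vy; apply/esym/mdist_small_eq => e /gV[j jP].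
  rewrite -[y](iter_cancel j hK); apply: jP.
  by elim: j => //= j /hV.
have : Lim X x by rewrite Lx.
apply; apply/Iso_open_set1; rewrite (_ : [set x] = V) //.
by apply/seteqP; split=> [_ -> //|y /V1].
Qed.
End Trap.

(** * Limit points of a hyper-expansive homeomorphism *)

Section Necessity.
Variables (R : realType) (X : metricType R).
Variable f : {splitbij [set: X] >-> [set: X]}.
Hypothesis cX : compact [set: X].
Hypotheses (cf : homeomorphism f) (hf : hyper_expansive f).
Local Notation fV := (f^-1)%FUN.

Lemma Lim_trap x : Lim X x -> exists N V,
  traps (iter N.+1 f) V x \/ traps (iter N.+1 fV) V x.
Proof.
move=> Lx; have [cf1 cfV] := cf.
have fK := splitbij_cancel f; have fVK := splitbij_cancelV f.
have [d d0 /(_ x)[xd|xd]] := hyper_expansive_expands cX hf.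
  have [N [V NV]] := expands_trap cX cfV fK fVK Lx d0 xd.
  by exists N, V; left.
have [N [V NV]] := expands_trap cX cf1 fVK fK Lx d0 xd.
by exists N, V; right.
Qed.

Lemma Lim_periodic x : Lim X x ->
  exists k, iter k.+1 f x = x /\ iter k.+1 fV x = x.
Proof.
have fK := splitbij_cancel f; have fVK := splitbij_cancelV f.
move=> /Lim_trap[N [V [t|t]]]; exists N; have [cf1 cfV] := cf.
  have fx := trap_fixed (iter_continuous (n := N.+1) cf1) t.
  by split=> //; rewrite -[in LHS]fx (iter_cancel _ fK).
have fx := trap_fixed (iter_continuous (n := N.+1) cfV) t.
by split=> //; rewrite -[in LHS]fx (iter_cancel _ fVK).
Qed.

(** Limit points are periodic, and a trap contains a single periodic point. *)
Lemma hyper_expansive_finite_Lim : finite_set (Lim X).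
Proof.
apply: (compact_discrete_finite cX); first exact: closed_Lim.
move=> x /Lim_trap[N [V t]]; exists V; have [oV Vx] : open V /\ V x.
  by case: t => -[].
split=> // y /Lim_periodic[k [fy fVy]] Vy.
have per (g : X -> X) : iter k.+1 g y = y -> iter k.+1 (iter N.+1 g) y = y.
  move=> gy; rewrite -iterM mulnC iterM.
  by elim: N.+1 => // n IH; rewrite iterS IH.
by case: t => t; apply: (trap_periodic t Vy (k := k)); exact: per.
Qed.

Lemma hyper_expansive_Lim_neq1 x : Lim X <> [set x].
Proof.
have fK := splitbij_cancel f; have fVK := splitbij_cancelV f.
move=> Lx; have : Lim X x by rewrite Lx.
by move=> /Lim_trap[N [V [t|t]]]; move: Lx; apply: trap_Lim_neq1 t => //;
  exact: iter_cancel.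
Qed.

End Necessity.

(** * Funnels, and hyper-expansivity of maps with funnels *)

Section Funnels.
Variables (R : realType) (X : metricType R).
Implicit Types (x y p q : X) (A B F U V : set X).

(** The set in the second clause consists of the points through which orbits
    of [g] enter [V]. *)
Definition funnel (g h : X -> X) V p : Prop :=
  [/\ forall y, V y -> V (g y), finite_set (V `&` [set y | ~ V (h y)]) &
    forall y, V y -> y <> p -> exists n, ~ V (iter n h y)].

Lemma finite_avoid F p : finite_set F -> ~ F p -> nbhs p (~` F).
Proof.
move=> finF nFp.
have [|s Fs|e e0 pe] := finite_uniform_radius (R := R)
    (P := fun s e => e <= mdist p s) finF.
- by move=> s e e' pe _ /le_trans; exact.
- exists (mdist p s) => //; rewrite mdist_gt0; apply/eqP => ps.
  by apply: nFp; rewrite ps.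
by apply/nbhs_mdist; exists e => // y py /pe; rewrite leNgt py.
Qed.

Hypothesis cX : compact [set: X].

(** Inside [V], the points not mapped by [g] into a given neighbourhood of [p]
    either leave [V] or come from the complement of that neighbourhood in
    [V]; both sets are finite and avoid [p]. *)
Lemma almost_invariant_continuous (g h : X -> X) V p :
  cancel g h -> cancel h g -> g p = p ->
  closed V -> nbhs p V -> (forall q, Lim X q -> V q -> q = p) ->
  finite_set (V `&` [set y | ~ V (g y)]) -> {for p, continuous g}.
Proof.
move=> gK hK gp cV Vp VL finV U; rewrite gp => Up.
have finVU : finite_set (V `\` interior U).
  apply: (closed_noLim_finite cX) => [|x [Vx nUx] Lx].
    by rewrite setDE; apply: closedI => //; apply/open_closedC/open_interior.
  by apply: nUx; rewrite (VL x Lx Vx); exact: Up.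
have finE : finite_set (V `&` [set y | ~ V (g y)] `|` h @` (V `\` interior U)).
  by rewrite finite_setU; split=> //; exact: finite_image.
have nEp : ~ (V `&` [set y | ~ V (g y)] `|` h @` (V `\` interior U)) p.
  move=> [[Vp' /=]|[z [Vz nUz] zp]]; first by rewrite gp.
  apply: nUz; suff -> : z = p by exact: Up.
  by rewrite -[z]hK zp.
apply: (filterS _ (filterI Vp (finite_avoid finE nEp))) => y [Vy nEy].
apply: (@interior_subset _ U); apply: contrapT => nUgy; apply: nEy.
have [Vgy|nVgy] := pselect (V (g y)); [right|by left].
by exists (g y).
Qed.

End Funnels.

(** The partition of X into clopen sets V_p is given by a map [c] assigning to
    each point a limit point, and to every point near a limit point [p] the
    point [p] itself; V_p is the fibre of [c] at [p]. *)
Section Criterion.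
Variables (R : realType) (X : metricType R).
Implicit Types (x y p q : X) (A B F U : set X).
Hypothesis cX : compact [set: X].
Variables (c : X -> X) (r : R).
Hypotheses (r_gt0 : 0 < r) (finL : finite_set (Lim X)).
Hypothesis cL : forall x, Lim X (c x).
Hypothesis c_ball : forall p x, Lim X p -> mdist p x < r -> c x = p.
Local Notation V p := [set x | c x = p].

Lemma c_Lim p : Lim X p -> c p = p.
Proof. by move=> Lp; apply: c_ball => //; rewrite mdistxx. Qed.

Lemma nbhs_fiber p : Lim X p -> nbhs p (V p).
Proof. by move=> Lp; apply/nbhs_mdist; exists r => // y; exact: c_ball. Qed.

Lemma closed_fiber p : closed (V p).
Proof.
rewrite -openC; apply: open_nbhs_Lim => q Lq; rewrite /setC /= c_Lim // => qp.
by apply: (filterS _ (nbhs_fiber Lq)) => y /= ->.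
Qed.

Lemma closed_fiber_finite p F : closed F -> ~ F p -> finite_set (F `&` V p).
Proof.
move=> cF nFp; apply: (closed_noLim_finite cX) => [|x [Fx /= cx] Lx].
  by apply: closedI => //; exact: closed_fiber.
by apply: nFp; rewrite -cx c_Lim.
Qed.

Lemma funnels_continuous (g h : X -> X) : cancel g h -> cancel h g ->
  (forall p, Lim X p -> g p = p) ->
  (forall p, Lim X p -> funnel g h (V p) p \/ funnel h g (V p) p) ->
  continuous g.
Proof.
move=> gK hK gL gh x.
have [Lx|/notLimP/Iso_open_set1 ox] := pselect (Lim X x); last first.
  move=> U Ugx; suff : nbhs x (g @^-1` U) by [].
  apply: (@filterS _ _ _ [set x]) => [_ ->|].
    exact: (nbhs_singleton Ugx).
  exact: open_nbhs_nbhs.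
apply: (almost_invariant_continuous cX gK hK (gL x Lx) (closed_fiber (p := x))).
- exact: nbhs_fiber.
- by move=> q Lq /=; rewrite c_Lim.
case: (gh x Lx) => -[gV finV _] //.
rewrite (_ : _ `&` _ = set0) // -subset0 => y [/gV /= ]; exact.
Qed.

(** The finitely many entrance points of the funnels of [g] are isolated, being
    different from the limit points, which [h] fixes. *)
Lemma funnel_gates_isolated (g h : X -> X) : (forall p, Lim X p -> h p = p) ->
  exists2 e : R, 0 < e & forall p, Lim X p -> funnel g h (V p) p ->
    forall y z, c y = p -> c (h y) <> p -> mdist y z < e -> z = y.
Proof.
move=> hL; apply: finite_uniform_radius => //
  [p e e' ge _ e'e fp y z cy chy yz|p Lp].
  by apply: (ge fp y z cy chy); exact: lt_le_trans e'e.
have [[_ finV _]|nf] := pselect (funnel g h (V p) p); last by exists 1.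
have [|y [/= cy chy]|e e0 eP] := finite_uniform_radius (R := R)
    (P := fun y e => forall z, mdist y z < e -> z = y) finV.
- by move=> y e e' ye _ e'e z yz; apply: ye; exact: lt_le_trans e'e.
- apply/IsoP/notLimP => Ly; apply: chy.
  by rewrite hL.
by exists e => // _ y z cy chy; apply: eP.
Qed.

Lemma first_exit (h : X -> X) U x n : U x -> ~ U (iter n h x) ->
  exists k, U (iter k h x) /\ ~ U (iter k.+1 h x).
Proof.
elim: n => // n IH Ux nU.
have [Un|nUn] := pselect (U (iter n h x)); last exact: IH.
by exists n.
Qed.

(** Suppose that the backward iterates of A stay within [d] of those of B, and
    let [a] in A lie in the funnel of [p].  If [a <> p], then the orbit of [a]
    leaves the funnel backwards through an entrance point, where being
    [d]-close means being equal.  If [a = p] is not in B, then the finitely many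
    points of B in the funnel leave it, and at that time no point of B is close
    to the fixed point [p]. *)
Lemma funnel_shadow (g h : X -> X) p (d : R) A B : cancel g h -> cancel h g ->
  Lim X p -> h p = p -> funnel g h (V p) p -> closed B -> d <= r ->
  (forall y z, c y = p -> c (h y) <> p -> mdist y z < d -> z = y) ->
  (forall n a, A a -> exists2 b, B b & mdist (iter n h a) (iter n h b) < d) ->
  forall a, A a -> c a = p -> B a.
Proof.
move=> gK hK Lp hp [gV _ Vout] cB dr gate shadow a Aa ca.
have [ap|nap] := pselect (a = p); last first.
  have [n] := Vout a ca nap.
  move=> /(first_exit (U := V p) ca)[k /= [ck ck1]].
  have [b Bb /(gate _ _ ck ck1)] := shadow k a Aa.
  by move=> /(can_inj (iter_cancel k hK)) <-.
apply: contrapT; rewrite ap => nBp.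
have hVC y : c y <> p -> c (h y) <> p by move=> cy /gV /=; rewrite hK.
have [||n nP] := finite_uniform_time (closed_fiber_finite cB nBp)
    (P := fun b n => c (iter n h b) <> p).
- by move=> b n; rewrite iterS; exact: hVC.
- move=> b [Bb /= cb]; apply: Vout => // bp.
  by apply: nBp; rewrite -bp.
have [b Bb] := shadow n a Aa.
rewrite ap (_ : iter n h p = p); last by elim: n {nP} => //= n ->.
move=> /lt_le_trans/(_ dr)/(c_ball Lp).
have [cb|ncb] := pselect (c b = p); first exact: nP.
by elim: n {nP} => //= n IH /hVC; exact.
Qed.

Lemma funnels_hyper_expansive (f : {splitbij [set: X] >-> [set: X]}) :
  (forall p, Lim X p -> f p = p) ->
  (forall p, Lim X p ->
     funnel f (f^-1)%FUN (V p) p \/ funnel (f^-1)%FUN f (V p) p) ->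
  homeomorphism f /\ hyper_expansive f.
Proof.
move=> fL fun_f; have fK := splitbij_cancel f; have fVK := splitbij_cancelV f.
have fVL p : Lim X p -> (f^-1)%FUN p = p.
  by move=> Lp; rewrite -[in LHS](fL p Lp) fK.
split.
  split; first exact: (funnels_continuous fK fVK).
  by apply: (funnels_continuous fVK fK) => // p /fun_f[]; [right|left].
have [d1 d1_gt0 gate1] := funnel_gates_isolated f fVL.
have [d2 d2_gt0 gate2] := funnel_gates_isolated (f^-1)%FUN fL.
pose d := Num.min r (Num.min d1 d2).
have [dr dd1 dd2] : [/\ d <= r, d <= d1 & d <= d2].
  by rewrite /d !ge_min !lexx !orbT.
exists d; first by rewrite !lt_min r_gt0 d1_gt0.
move=> A B [A0 kA] [B0 kB] AB.
have cA : closed A by apply: compact_closed => //; exact: metric_hausdorff.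
have cB : closed B by apply: compact_closed => //; exact: metric_hausdorff.
have img0 (D : set X) n : D !=set0 -> int_iter f n @` D !=set0.
  by move=> [a Da]; exists (int_iter f n a), a.
have shadow n :
    (forall a, A a -> exists2 b, B b &
       mdist (int_iter f n a) (int_iter f n b) < d) /\
    (forall b, B b -> exists2 a, A a &
       mdist (int_iter f n b) (int_iter f n a) < d).
  have [AnB BnA] := hausdorff_dist_lt cX (img0 A n A0) (img0 B n B0) (AB n).
  split=> x Dx.
    have [|_ [y By <-] xy] := AnB (int_iter f n x); first by exists x.
    by exists y.
  have [|_ [y Ay <-] xy] := BnA (int_iter f n x); first by exists x.
  by exists y.
have sub (D E : set X) : closed E ->
    (forall n a, D a -> exists2 b, E b &
       mdist (int_iter f n a) (int_iter f n b) < d) ->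
    D `<=` E.
  move=> cE DE a Da; have Lp := @cL a.
  have [fp|fp] := fun_f _ Lp.
    apply: (funnel_shadow fK fVK Lp (fVL _ Lp) fp cE dr _ _ Da) => //.
      move=> y z cy chy yz; apply: (gate1 _ Lp fp) => //.
      exact: lt_le_trans dd1.
    by move=> n; have [m <-] := int_iterV f n; exact: DE.
  apply: (funnel_shadow fVK fK Lp (fL _ Lp) fp cE dr _ _ Da) => //.
    move=> y z cy chy yz; apply: (gate2 _ Lp fp) => //.
    exact: lt_le_trans dd2.
  by move=> n; exact: (DE (Posz n)).
by apply/seteqP; split; apply: sub => // n; have [] := shadow n.
Qed.

End Criterion.

(** * Construction of a homeomorphism with one repeller *)

Lemma denumerable_enum (T : Type) (A : set T) : countable A -> infinite_set A ->
  exists e : nat -> T,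
    [/\ injective e, forall k, A (e k) & forall x, A x -> exists k, e k = x].
Proof.
move=> cA iA; have /card_set_bijP[n [_ n_inj n_surj]] := eq_card_nat cA iA.
have /choice[e eP] : forall k, exists x, A x /\ n x = k.
  by move=> k; have [x Ax nx] := n_surj k I; exists x.
exists e; split=> [k l ekl|k|x Ax].
- by have [_ <-] := eP k; have [_ <-] := eP l; rewrite ekl.
- by have [] := eP k.
- by exists (n x); have [Ae ne] := eP (n x); apply: n_inj => //; exact: mem_set.
Qed.

Section Retraction.
Variables (R : realType) (X : metricType R).
Implicit Types (x y p q : X).

Lemma finite_Lim_retraction p1 : finite_set (Lim X) -> Lim X p1 ->
  exists (c : X -> X) (r : R), [/\ 0 < r, forall x, Lim X (c x) &
    forall p x, Lim X p -> mdist p x < r -> c x = p].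
Proof.
move=> finL Lp1.
have [e e0 sep] : exists2 e : R, 0 < e & forall p, Lim X p ->
    forall q, Lim X q -> mdist p q < e -> q = p.
  apply: finite_uniform_radius => // [p e e' sep _ e'e q Lq pq|p Lp].
    by apply: sep => //; exact: lt_le_trans e'e.
  have [||e e0 eP] :=
    (nbhs_mdist p _).1 (@finite_avoid _ _ (Lim X `\ p) p _ _).
  - exact: finite_setD.
  - by case=> _; apply.
  - by exists e => // q Lq /eP nq; apply: contrapT => qp; apply: nq.
pose c x := xget p1 [set p | Lim X p /\ mdist p x < e / 2].
exists c, (e / 2); split=> [|x|p x Lp px]; first by lra.
  by rewrite /c; case: xgetP => [y _ []|].
apply: xget_unique => // q [Lq qx]; apply: sep => //.
by have := metric_triangle p x q; rewrite (metric_sym x q); lra.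
Qed.

End Retraction.

Section Construction.
Variables (R : realType) (X : metricType R).
Implicit Types (x y p q : X).
Hypothesis cX : compact [set: X].
Variables (c : X -> X) (r : R).
Hypotheses (r_gt0 : 0 < r) (finL : finite_set (Lim X)).
Hypothesis cL : forall x, Lim X (c x).
Hypothesis c_ball : forall p x, Lim X p -> mdist p x < r -> c x = p.
Local Notation V p := [set x | c x = p].

(** A fibre minus its limit point [q] is countable because it has finitely many
    points at distance at least 1 / (k + 1) from [q], and infinite because [q]
    is not isolated. *)
Lemma fiber_enum q : Lim X q -> exists e : nat -> X,
  [/\ injective e, forall k, c (e k) = q /\ e k <> q &
      forall y, c y = q -> y <> q -> exists k, e k = y].
Proof.
move=> Lq; have [||e [ei eq eS]] := @denumerable_enum _ (V q `\ q).
- rewrite (_ : _ `\ _ = \bigcup_(k in [set: nat])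
      ((~` [set y | mdist q y < k.+1%:R^-1]) `&` V q)).
    apply: bigcup_countable => // k _; apply: finite_set_countable.
    apply: (closed_fiber_finite cX r_gt0 c_ball).
      exact/open_closedC/open_mdist_ball.
    by rewrite /setC /= mdistxx; apply; rewrite invr_gt0.
  apply/seteqP; split=> [y [cy yq]|y [k _ [qy cy]]].
    have qy0 : 0 < mdist q y by rewrite mdist_gt0; apply/eqP => ?; exact: yq.
    exists (Num.truncn (mdist q y)^-1) => //; split=> //= qy.
    move: qy; apply/negP; rewrite -leNgt -[leRHS]invrK.
    by rewrite lef_pV2 ?posrE ?invr_gt0 // ltW // truncnS_gt.
  split=> // yq; apply: qy; rewrite yq /= mdistxx invr_gt0 //.
- move=> finV; have nq : ~ (V q `\ q) q by case=> _; exact.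
  have [b b0 qb] := (nbhs_mdist q _).1
    (filterI (finite_avoid finV nq) (nbhs_fiber r_gt0 c_ball Lq)).
  apply: Lq; apply/IsoP; exists b => // y /qb[nVy cy].
  by apply: contrapT => yq; apply: nVy.
by exists e; split=> // y cy yq; apply: eS.
Qed.

Variable p1 : X.
Hypothesis Lp1 : Lim X p1.
Local Notation Q := (Lim X `\ p1).

(** The orbit of index [q] occupies the fibre of [q] at nonnegative times, and
    part of the fibre of [p1] at negative times.  The fibre of [p1] is shared
    among all indices by means of a bijection between [Q `*` setT] and the
    natural numbers. *)
Lemma orbit_coding : Q !=set0 -> exists phi : X -> int -> X,
  [/\ forall q m, Q q -> c (phi q m) = if 0 <= m then q else p1,
      forall q m, Q q -> ~ Lim X (phi q m),
      forall q q' m m', Q q -> Q q' -> phi q m = phi q' m' ->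
        q = q' /\ m = m' &
      forall x, ~ Lim X x -> exists q m, Q q /\ phi q m = x].
Proof.
move=> [q0 Qq0].
have /choice[e eP] : forall q, exists e : nat -> X, Lim X q ->
    [/\ injective e, forall k, c (e k) = q /\ e k <> q &
        forall y, c y = q -> y <> q -> exists k, e k = y].
  move=> q; have [/fiber_enum[e ?]|?] := pselect (Lim X q); first by exists e.
  by exists (fun=> q).
have /card_set_bijP[i [_ i_inj i_surj]] :
    (Q `*` [set: nat] #= [set: nat])%card.
  apply: eq_card_nat.
    apply: countableX => //; apply: finite_set_countable.
    exact: finite_setD finL.
  move=> /(finite_image snd) fin; apply: infinite_nat.
  apply: sub_finite_set fin => k _.
  by exists (q0, k).
have [w_inj wP w_surj] := eP p1 Lp1.
pose phi q (m : int) := match m with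
  | Posz k => e q k | Negz k => e p1 (i (q, k)) end.
have phic q m : Q q -> c (phi q m) = if 0 <= m then q else p1.
  move=> [Lq _]; case: m => k /=; last by have [] := wP (i (q, k)).
  by have [_ /(_ k)[]] := eP q Lq.
have phiL q m : Q q -> ~ Lim X (phi q m).
  move=> Qq Lphi; have := phic q m Qq; rewrite (c_Lim r_gt0 c_ball Lphi).
  case: m {Lphi} => k /=; last by have [] := wP (i (q, k)).
  by have [_ /(_ k)[]] := eP q Qq.1.
exists phi; split=> // [q q' m m' Qq Qq'|x nLx].
  case: m m' => k [] k' phiE; have := congr1 c phiE; rewrite !phic //=.
  - move=> qq'; subst q'; split=> //; congr Posz.
    by have [e_inj _ _] := eP q Qq.1; exact: e_inj.
  - by move=> /Qq.2.
  - by move=> /esym/Qq'.2.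
  move=> _; have qk : (q, k) = (q', k').
    by apply: i_inj; [exact: mem_set|exact: mem_set|exact: w_inj].
  by case: qk => -> ->.
have nx : x <> c x by move=> xc; apply: nLx; rewrite xc; exact: cL.
have [cx|ncx] := pselect (c x = p1).
  have [k kx] := w_surj x cx (ltac:(by rewrite -cx)).
  have [[q n] [/= Qq _] ik] := i_surj k I.
  by exists q, (Negz n); split=> //=; rewrite ik.
have [_ _ /(_ x erefl nx)[k kx]] := eP (c x) (@cL x).
by exists (c x), (Posz k); split=> //; split.
Qed.

(** The homeomorphism fixes the limit points and adds 1 to the time coordinate
    of the coding. *)
Lemma attractors_repeller_homeo : Q !=set0 ->
  exists f : {splitbij [set: X] >-> [set: X]},
    homeomorphism f /\ hyper_expansive f.
Proof.
move=> /orbit_coding[phi [phic phiL phi_inj phi_surj]].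
have transport (t : int -> int) : exists g : X -> X,
    (forall p, Lim X p -> g p = p) /\
    (forall q m, Q q -> g (phi q m) = phi q (t m)).
  have /choice[g gP] : forall x, exists y, (Lim X x -> y = x) /\
      (forall q m, Q q -> x = phi q m -> y = phi q (t m)).
    move=> x; have [Lx|/phi_surj[q [m [Qq <-]]]] := pselect (Lim X x).
      by exists x; split=> // q m Qq xphi; case: (phiL q m Qq); rewrite -xphi.
    exists (phi q (t m)); split=> [/phiL|q' m' Qq' /phi_inj[]// -> ->//].
    by case.
  exists g; split=> [p Lp|q m Qq]; first exact: (gP p).1.
  exact: (gP _).2 Qq erefl.
have [f [fL fphi]] := transport (fun m => m + 1).
have [g [gL gphi]] := transport (fun m => m - 1).
have fK : cancel f g.
  move=> x; have [Lx|/phi_surj[q [m [Qq <-]]]] := pselect (Lim X x).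
    by rewrite fL // gL.
  by rewrite fphi // gphi // addrK.
have gK : cancel g f.
  move=> x; have [Lx|/phi_surj[q [m [Qq <-]]]] := pselect (Lim X x).
    by rewrite gL // fL.
  by rewrite gphi // fphi // subrK.
have [F fF] := PbijTT (Bijective fK gK).
have gF : g = (F^-1)%FUN.
  by apply/funext => x; rewrite -[in RHS](gK x) fF splitbij_cancel.
have iter_f n q m : Q q -> iter n f (phi q m) = phi q (m + n%:Z).
  move=> Qq; elim: n => [|n IH]; first by rewrite addr0.
  by rewrite iterS IH fphi //; congr phi; lia.
have iter_g n q m : Q q -> iter n g (phi q m) = phi q (m - n%:Z).
  move=> Qq; elim: n => [|n IH]; first by rewrite subr0.
  by rewrite iterS IH gphi //; congr phi; lia.
have pos q m : Q q -> c (phi q m) = q <-> 0 <= m.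
  by move=> Qq; rewrite phic //; case: ifP => // _; split=> // /esym/Qq.2.
have neg q m : Q q -> c (phi q m) = p1 <-> m < 0.
  move=> Qq; rewrite phic // ltNge.
  by case: ifP => // _; split=> // /Qq.2.
have coded q y : y <> q -> c y = q -> exists q' m, Q q' /\ phi q' m = y.
  move=> yq cy; apply: phi_surj => /(c_Lim r_gt0 c_ball).
  by rewrite cy => /esym.
have attracting q : Q q -> funnel f g (V q) q.
  move=> Qq.
  have qcoded y : y <> q -> c y = q -> exists2 m, 0 <= m & phi q m = y.
    move=> yq cy; have [q' [m [Qq' phiy]]] := coded q y yq cy; move: cy.
    rewrite -phiy phic //; case: ifP => [m0 <-|_ /esym/Qq.2 //].
    by exists m.
  split.
  - move=> y /= cy; have [->|/qcoded/(_ cy)[m m0 <-]] := pselect (y = q).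
      by rewrite fL ?Qq.1 ?(c_Lim r_gt0 c_ball Qq.1) //; exact: Qq.1.
    by rewrite fphi //; apply/pos => //; lia.
  - apply: (sub_finite_set _ (finite_set1 (phi q 0))) => y [/= cy cgy].
    have [yq|/qcoded/(_ cy)[m m0 my]] := pselect (y = q).
      by case: cgy; rewrite yq gL ?(c_Lim r_gt0 c_ball Qq.1) //; exact: Qq.1.
    move: cgy; rewrite -my gphi // pos // => /negP; rewrite -ltNge => m1.
    by congr phi; lia.
  - move=> y cy yq; have [m m0 <-] := qcoded y yq cy.
    exists `|m|.+1%N => /=.
    by rewrite -iterS iter_g // pos //; lia.
have repelling : funnel g f (V p1) p1.
  have pcoded y : y <> p1 -> c y = p1 ->
      exists q m, [/\ Q q, m < 0 & phi q m = y].
    move=> yq cy; have [q [m [Qq phiy]]] := coded p1 y yq cy.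
    by exists q, m; split=> //; apply/(neg q m Qq); rewrite phiy.
  split.
  - move=> y /= cy.
    have [->|/pcoded/(_ cy)[q [m [Qq m0 <-]]]] := pselect (y = p1).
      by rewrite gL // (c_Lim r_gt0 c_ball Lp1).
    by rewrite gphi //; apply/neg => //; lia.
  - have finQ : finite_set Q by exact: finite_setD finL.
    apply: (sub_finite_set _ (finite_image (fun q => phi q (-1)) finQ)).
    move=> y [/= cy cfy].
    have [yq|/pcoded/(_ cy)[q [m [Qq m0 my]]]] := pselect (y = p1).
      by case: cfy; rewrite yq fL // (c_Lim r_gt0 c_ball Lp1).
    move: cfy; rewrite -my fphi // neg // => /negP; rewrite -leNgt => m1.
    by exists q => //; congr phi; lia.
  - move=> y cy yq; have [q [m [Qq m0 <-]]] := pcoded y yq cy.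
    exists `|m|%N.
    by rewrite iter_f //= neg //; lia.
exists F; apply: (funnels_hyper_expansive cX r_gt0 finL cL c_ball);
  rewrite -?gF -?fF //.
move=> p Lp; have [->|pp1] := pselect (p = p1); [right|left] => //.
exact: attracting.
Qed.

End Construction.

(** * The finite case and the characterization *)

Section Finite.
Variables (R : realType) (X : metricType R).
Hypothesis cX : compact [set: X].

Lemma no_Lim_hyper_expansive : Lim X = set0 ->
  exists f : {splitbij [set: X] >-> [set: X]},
    homeomorphism f /\ hyper_expansive f.
Proof.
move=> L0; have idK : cancel (@id X) id by [].
have [F idF] := PbijTT (Bijective idK idK).
have Fi : (F^-1)%FUN = id.
  by apply/funext => x; rewrite -[in LHS](_ : F x = x) ?splitbij_cancel -?idF.
have finX : finite_set [set: X].
  by apply: (closed_noLim_finite cX) => [|x _]; [exact: closedT|rewrite L0].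
have [|x _|d d0 dP] := finite_uniform_radius (R := R)
    (P := fun x e => forall y, mdist x y < e -> y = x) finX.
- by move=> x e e' xe _ e'e y xy; apply: xe; exact: lt_le_trans e'e.
- by apply/IsoP/notLimP; rewrite L0.
exists F; split; first by split; rewrite ?Fi -?idF => x; exact: cvg_id.
exists d => // A B [A0 _] [B0 _] /(_ 0) /=.
rewrite -idF !image_id => /(hausdorff_dist_lt cX A0 B0)[AB BA].
by apply/seteqP; split=> x; [move=> /AB|move=> /BA] => -[y Dy xy];
  rewrite -(dP x I y xy).
Qed.

End Finite.

Theorem theorem2p8 (R : realType) (X : metricType R)
    (cX : compact [set: X]) :
  (exists f : {splitbij [set: X] >-> [set: X]},
     homeomorphism f /\ hyper_expansive f) <->
  ((exists2 n : nat, (2 <= n)%N & (Lim X #= `I_n)%card) \/ Lim X = set0).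
Proof.
split=> [[f [cf hf]]|[[n n2 Ln]|L0]]; last exact: no_Lim_hyper_expansive.
  have [[|[|n]] Ln] := hyper_expansive_finite_Lim cX cf hf.
  - by right; apply/eqP; rewrite -(@card_eq0 _ nat) -II0.
  - have /eq_cardSP[x Lx] := Ln.
    rewrite II0 card_eq0 => /eqP L1; exfalso.
    apply: (hyper_expansive_Lim_neq1 cX cf hf (x := x)).
    by rewrite -(setD1K Lx) L1 setU0.
  - by left; exists n.+2.
have finL : finite_set (Lim X) by exists n.
case: n n2 Ln => [|[|n]] // _ /eq_cardSP[p1 Lp1 /eq_cardSP[q [Lq qp1] _]].
have [c [r [r0 cL c_ball]]] := finite_Lim_retraction finL Lp1.
by apply: (attractors_repeller_homeo cX r0 finL cL c_ball Lp1); exists q.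
Qed.
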